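(* Let $G$ be a $2$-regular separable locally compact abelian group, $m$ a symplectic bicharacter of $G$, and $L\subset G$ a compact subgroup which is maximal isotropic for $m$ and satisfies $L\neq 2L$. Let $W$ be an irreducible $m$-representation of $G$ on a Hilbert space $\mathcal{H}$, let $\mathcal{H}^L=\{\psi\in\mathcal{H} : W(a)\psi=\psi\ \forall a\in L\}$, and let $W^L$ be the $m$-representation $W|_{L/2}$ of $L/2$ acting on $\mathcal{H}^L$. Let $W^L_0$ be a projective representation of $(L/2)/L$ on $\mathcal{H}^L$ whose lift to $L/2$ is projectively equivalent to $W^L$, and let $d$ be the positive integer with $|(L/2)/L|=2^{2d}$. Then for the projective representation $W^L_0$ of $(L/2)/L$ there is a basis $(e_i)_{i=1}^{2d}$ for $(L/2)/L$ (as a vector space over $\mathbf{F}_2=\mathbf{Z}/2\mathbf{Z}$) such that $$W^L_0(e_i)^2=1,\qquad W^L_0(e_i)W^L_0(e_j)=-W^L_0(e_j)W^L_0(e_i)\quad (i\neq j).$$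
   Context: Groups are written additively. $T=\{z\in\mathbf{C}:|z|=1\}$. A bicharacter of $G$ is a continuous map $m:G\times G\to T$ which is a character in each argument; it is alternating if $m(x,y)m(y,x)=1$ and $m(x,x)=1$ for all $x,y$, and symplectic if it is alternating and the induced morphism $\beta:G\to\widehat{G}$, $(x,\beta(y))=m(x,y)$, is an isomorphism. $G$ is $2$-regular if $x\mapsto 2x$ is a bijection of $G$. For a subset $A\subset G$, $A/2=\{x\in G:2x\in A\}$ and $2A=\{2a:a\in A\}$. A subgroup $A$ is isotropic for $m$ if $m\equiv 1$ on $A\times A$; maximal isotropic means maximal with respect to inclusion among isotropic subgroups. A multiplier of an abelian group $H$ is a Borel map $n:H\times H\to T$ with $n(x,0)=n(0,x)=1$ and $n(x+y,z)n(x,y)=n(x,y+z)n(y,z)$. An $n$-representation of $H$ is a Borel map $U$ of $H$ into the unitary group of a Hilbert space with $U(0)=1$ and $U(x)U(y)=n(x,y)U(x+y)$; a projective representation is an $n$-representation for some multiplier $n$. A projective representation is irreducible if its Hilbert space is nonzero and has no closed invariant subspaces other than $0$ and the whole space. The subspace $\mathcal{H}^L$ is invariant under $W(x)$ for $x\in L/2$. The group $(L/2)/L$ is finite, every element $v$ of it satisfies $2v=0$, so it is a finite-dimensional vector space over $\mathbf{F}_2$, and its dimension $2d$ is even and positive. With $\pi:L/2\to(L/2)/L$ the canonical projection, the lift of $W_0^L$ to $L/2$ is $W^L_0\circ\pi$; it is projectively equivalent to $W^L$ if there is a function $a:L/2\to T$ with $W^L_0(\pi(x))=a(x)W^L(x)$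 for all $x\in L/2$. A projective representation $W_0^L$ as in the claim exists, and its multiplier $m_{0,L/2}$ is characterized up to equivalence by $m_{0,L/2}^\sim(\pi(x),\pi(y))=m^\sim(x,y)$ for $x,y\in L/2$, where $n^\sim(x,y)=n(x,y)/n(y,x)$ for a multiplier $n$.
   Formalization: The relation W_0^L(e_i)^2=1 fails for arbitrary W_0^L (it changes under rescaling by phases), so it is proved for a projective representation projectively equivalent to W_0^L, with the same basis; the anticommutation relations are proved for W_0^L itself as well. *)

(* Defs.v *)
From HB Require Import structures.
From mathcomp Require Import all_boot all_order all_algebra.
From mathcomp Require Import generic_quotient ring_quotient sesquilinear.
From mathcomp Require Export complex.
From mathcomp Require Import all_classical all_reals all_analysis.

Set Implicit Arguments.
Unset Strict Implicit.
Unset Printing Implicit Defensive.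

Import Order.TTheory GRing.Theory Num.Theory.
Import numFieldNormedType.Exports.

Local Open Scope classical_set_scope.
Local Open Scope ring_scope.
Local Open Scope quotient_scope.

(* Throughout, K is the field of complex scalars.  The definitions only use    *)
(* the structure numClosedFieldType; they are meant for K := R[i] with         *)
(* R : realType.  The circle T is the set of the z : K with `|z| = 1, and      *)
(* T-valued maps are K-valued maps of modulus 1.                               *)

Definition borel_set (X : topologicalType) : set (set X) := <<s @open X>>.

Definition borel_fun (X Y : topologicalType) (f : X -> Y) :=
  forall B : set Y, borel_set B -> borel_set (f @^-1` B).

(* Second countability implies this, and some authors mean the former by       *)
(* "separable"; the weaker condition is used.                                  *)
Definition separable (X : topologicalType) :=
  exists2 D : set X, countable D & dense D.

Lemma subr_continuous (M : topologicalZmodType) (a : M) :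
  continuous (fun x : M => x - a).
Proof.
move=> x; apply: (@continuous_comp M (M * M)%type M
  (fun x => (x, a)) (fun q => q.1 - q.2)); last exact: sub_continuous.
by apply: cvg_pair => /=; [exact: cvg_id|exact: cvg_cst].
Qed.

HB.mixin Record hasInnerProduct (K : numClosedFieldType) H
    of CompleteNormedModule K H := {
  inner : {dot H for (@Num.conj K : K -> K)} ;
  sqr_normE : forall x : H, `|x| ^+ 2 = inner x x
}.

#[short(type="hilbertType")]
HB.structure Definition Hilbert (K : numClosedFieldType) :=
  {H of hasInnerProduct K H & CompleteNormedModule K H}.

Record unitary (K : numClosedFieldType) (H : hilbertType K) := Unitary {
  unitary_fun :> {linear H -> H} ;
  unitary_inner : forall x y, inner (unitary_fun x) (unitary_fun y) = inner x y ;
  unitary_surj : forall y, exists x, unitary_fun x = y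
}.

Section UnitaryTopology.
Variables (K : numClosedFieldType) (H : hilbertType K).

HB.instance Definition _ := gen_eqMixin (unitary H).
HB.instance Definition _ := gen_choiceMixin (unitary H).

(* The unitary group carries the strong operator topology. *)
Definition unitary_ptws (U : unitary H) : {ptws H -> H} := U.

HB.instance Definition _ :=
  Topological.copy (unitary H) (initial_topology unitary_ptws).

Lemma unitary_norm (U : unitary H) x : `|U x| = `|x|.
Proof.
apply/eqP; rewrite -(@eqrXn2 _ 2) ?normr_ge0// !sqr_normE.
by rewrite unitary_inner.
Qed.

Lemma unitary_continuous (U : unitary H) : continuous U.
Proof.
move=> x; apply/cvgrPdist_lt => e e0.
near=> y; rewrite -linearB unitary_norm.
by near: y; apply: cvgr_dist_lt.
Unshelve. all: by end_near. Qed.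

End UnitaryTopology.

Section Bicharacters.
Variables (K : numClosedFieldType) (G : topologicalZmodType).

Definition is_character (chi : G -> K) :=
  [/\ continuous chi, forall x, `|chi x| = 1
    & forall x y, chi (x + y) = chi x * chi y].

Record dual := Character {
  character_fun :> G -> K ;
  characterP : is_character character_fun
}.

HB.instance Definition _ := gen_eqMixin dual.
HB.instance Definition _ := gen_choiceMixin dual.

Definition dual_co (chi : dual) : {compact-open, G -> K} := character_fun chi.

HB.instance Definition _ := Topological.copy dual (initial_topology dual_co).

Record bicharacter := Bicharacter {
  bichar_fun :> G -> G -> K ;
  bichar_continuous : continuous (fun p : G * G => bichar_fun p.1 p.2) ;
  bichar_l : forall y, is_character (bichar_fun^~ y) ;
  bichar_r : forall x, is_character (bichar_fun x)
}.

Definition alternating (m : bicharacter) :=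
  (forall x y, m x y * m y x = 1) /\ (forall x, m x x = 1).

Definition bichar_dual (m : bicharacter) (y : G) : dual :=
  Character (bichar_l m y).

(* bichar_dual m is a morphism by bichar_r, so that being an isomorphism of    *)
(* topological groups only requires a continuous inverse.                      *)
Definition symplectic (m : bicharacter) :=
  alternating m /\
  [/\ continuous (bichar_dual m)
    & exists2 g : dual -> G, continuous g &
        cancel (bichar_dual m) g /\ cancel g (bichar_dual m)].

Definition isotropic (m : bicharacter) (A : zmodClosed G) :=
  forall x y, x \in A -> y \in A -> m x y = 1.

Definition maximal_isotropic (m : bicharacter) (A : zmodClosed G) :=
  isotropic m A /\
  forall B : zmodClosed G, isotropic m B -> {subset A <= B} -> {subset B <= A}.

End Bicharacters.

Section Representations.
Variables (K : numClosedFieldType) (A : topologicalZmodType).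

Record is_multiplier (n : A -> A -> K) : Prop := IsMultiplier {
  multiplier_norm : forall x y, `|n x y| = 1 ;
  multiplier_borel : borel_fun (fun p : A * A => n p.1 p.2) ;
  multiplier0r : forall x, n x 0 = 1 ;
  multiplier0l : forall x, n 0 x = 1 ;
  multiplierP : forall x y z, n (x + y) z * n x y = n x (y + z) * n y z
}.

Variable H : hilbertType K.

Record is_rep (n : A -> A -> K) (U : A -> unitary H) : Prop := IsRep {
  rep_borel : borel_fun U ;
  rep0 : forall psi, U 0 psi = psi ;
  repM : forall x y psi, U x (U y psi) = n x y *: U (x + y) psi
}.

Definition is_projective_rep (U : A -> unitary H) :=
  exists2 n : A -> A -> K, is_multiplier n & is_rep n U.

Definition irreducible_rep (U : A -> unitary H) :=
  (exists psi : H, psi != 0) /\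
  forall S : set H, closed S -> S 0 ->
    (forall c x y, S x -> S y -> S (c *: x + y)) ->
    (forall a x, S x -> S (U a x)) ->
    S = [set 0] \/ S = setT.

Definition projectively_equivalent (U V : A -> unitary H) :=
  exists2 a : A -> K, forall x, `|a x| = 1
    & forall x psi, U x psi = a x *: V x psi.

End Representations.

Definition is_basis (F : fieldType) (V : lmodType F) (n : nat)
    (e : 'I_n -> V) :=
  (forall v, exists c : 'I_n -> F, v = \sum_(i < n) c i *: e i) /\
  (forall c : 'I_n -> F, \sum_(i < n) c i *: e i = 0 -> forall i, c i = 0).

Definition two_regular (G : zmodType) := bijective (fun x : G => x *+ 2).

Definition half (G : zmodType) (L : zmodClosed G) : {pred G} :=
  [pred x | x *+ 2 \in L].

Section HalfZmod.
Variables (G : zmodType) (L : zmodClosed G).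

Lemma half_zmod_closed : zmod_closed (half L).
Proof.
split=> [|x y]; rewrite !inE ?mul0rn ?rpred0// => xL yL.
by rewrite mulrnBl rpredB.
Qed.

HB.instance Definition _ := GRing.isZmodClosed.Build G (half L) half_zmod_closed.

Definition half_group := {x : G | x \in half L}.

HB.instance Definition _ := SubChoice.on half_group.
HB.instance Definition _ := [SubChoice_isSubZmodule of half_group by <:].

(* L, seen inside L/2 *)
Definition in_half : {pred half_group} := [pred x | val x \in L].

Lemma in_half_zmod_closed : zmod_closed in_half.
Proof.
split=> [|x y]; rewrite !inE ?raddf0 ?rpred0// => xL yL.
by rewrite raddfB rpredB.
Qed.

HB.instance Definition _ :=
  GRing.isZmodClosed.Build half_group in_half in_half_zmod_closed.

Definition half_quot := Quotient.quot in_half.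

HB.instance Definition _ := GRing.Zmodule.on half_quot.

Definition half_pi (x : half_group) : half_quot := \pi_(Quotient.quot in_half) x.

Lemma half_pi_is_zmod_morphism : zmod_morphism half_pi.
Proof. by move=> x y; rewrite /half_pi raddfB. Qed.

HB.instance Definition _ :=
  GRing.isZmodMorphism.Build half_group half_quot half_pi
    half_pi_is_zmod_morphism.

Lemma half_pi_surj (v : half_quot) : exists x, half_pi x = v.
Proof. by exists (repr v); rewrite /half_pi reprK. Qed.

Lemma half_pi_eq0 x : (half_pi x == 0) = (val x \in L).
Proof.
by rewrite -(raddf0 half_pi) /half_pi -Quotient.idealrBE subr0.
Qed.

Lemma half_quot_mulr2n (v : half_quot) : v *+ 2 = 0.
Proof.
have [x <-] := half_pi_surj v.
by apply/eqP; rewrite -raddfMn half_pi_eq0 raddfMn /=; exact: (valP x).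
Qed.

(* The vector space structure over F_2: c in {0, 1} acts as multiplication by  *)
(* the natural number c.                                                       *)
Definition half_scale (c : 'F_2) (v : half_quot) : half_quot := v *+ (c : nat).

Lemma half_scale_mod (v : half_quot) n : v *+ (n %% 2) = v *+ n.
Proof.
by rewrite [in RHS](divn_eq n 2) mulrnDr mulnC mulrnA half_quot_mulr2n mul0rn add0r.
Qed.

Lemma half_scaleA a b v : half_scale a (half_scale b v) = half_scale (a * b) v.
Proof. by rewrite /half_scale -mulrnA /= half_scale_mod mulnC. Qed.

Lemma half_scale1 : left_id 1 half_scale. Proof. by []. Qed.

Lemma half_scaleDr : right_distributive half_scale +%R.
Proof. by move=> c u v; rewrite /half_scale mulrnDl. Qed.

Lemma half_scaleDl v : {morph half_scale^~ v : a b / a + b}.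
Proof. by move=> a b; rewrite /half_scale /= half_scale_mod mulrnDr. Qed.

HB.instance Definition _ := GRing.Zmodule_isLmodule.Build 'F_2 half_quot
  half_scaleA half_scale1 half_scaleDr half_scaleDl.

End HalfZmod.

Section HalfTopology.
Variables (G : topologicalZmodType) (L : zmodClosed G).

HB.instance Definition _ := Topological.copy (half_group L)
  (initial_topology (val : half_group L -> G)).

Lemma half_val_continuous : continuous (val : half_group L -> G).
Proof. exact: initial_continuous. Qed.

Lemma half_sub_continuous :
  continuous (fun p : half_group L * half_group L => p.1 - p.2).
Proof.
apply/continuousP => _ [B oB <-].
have : continuous (fun p : half_group L * half_group L => val p.1 - val p.2).
  move=> p; apply: (@continuous_comp _ _ _
    (fun p : half_group L * half_group L => (val p.1, val p.2))
    (fun q : G * G => q.1 - q.2)); last exact: sub_continuous.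
  apply: cvg_pair => /=.
    by apply: continuous_comp; [exact: cvg_fst|exact: half_val_continuous].
  by apply: continuous_comp; [exact: cvg_snd|exact: half_val_continuous].
by move=> /continuousP /(_ _ oB).
Qed.

HB.instance Definition _ :=
  PreTopologicalNmodule_isTopologicalZmodule.Build (half_group L)
    half_sub_continuous.

Definition half_quot_open (V : set (half_quot L)) := open (@half_pi G L @^-1` V).

Lemma half_quot_openT : half_quot_open setT.
Proof. by rewrite /half_quot_open preimage_setT; exact: openT. Qed.

Lemma half_quot_openI : setI_closed half_quot_open.
Proof. by move=> U V oU oV; rewrite /half_quot_open preimage_setI; exact: openI. Qed.

Lemma half_quot_open_bigcup (I : Type) (f : I -> set (half_quot L)) :
  (forall i, half_quot_open (f i)) -> half_quot_open (\bigcup_i f i).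
Proof.
by move=> fo; rewrite /half_quot_open preimage_bigcup; apply: bigcup_open => i _; exact: fo.
Qed.

HB.instance Definition _ := isOpenTopological.Build (half_quot L)
  half_quot_openT half_quot_openI half_quot_open_bigcup.

Lemma half_pi_continuous : continuous (@half_pi G L).
Proof. exact/continuousP. Qed.

Lemma half_pi_open (V : set (half_group L)) :
  open V -> open (@half_pi G L @` V).
Proof.
move=> oV; rewrite /open /= /half_quot_open.
have -> : @half_pi G L @^-1` (@half_pi G L @` V) =
    \bigcup_(a in [set a : half_group L | val a \in L]) ((fun x => x - a) @^-1` V).
  apply/seteqP; split=> x /=.
    move=> [y Vy yx]; exists (x - y); last by rewrite /= subKr.
    by rewrite /mkset -(half_pi_eq0 (x - y)) half_pi_is_zmod_morphism yx subrr.
  move=> [a aL Vxa]; exists (x - a) => //.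
  have /eqP a0 : half_pi a == 0 by rewrite half_pi_eq0.
  by rewrite half_pi_is_zmod_morphism a0 subr0.
apply: bigcup_open => a _.
by have /continuousP := @subr_continuous (half_group L) a; exact.
Qed.

Lemma half_quot_sub_continuous :
  continuous (fun p : half_quot L * half_quot L => p.1 - p.2).
Proof.
move=> [u v] /= B; have [x <-] := half_pi_surj u; have [y <-] := half_pi_surj v.
rewrite -half_pi_is_zmod_morphism => uvB.
have := @half_sub_continuous (x, y) _ (@half_pi_continuous (x - y) _ uvB).
case=> -[P Q] /= [Px Qy] PQ.
have [P' [oP' P'x] P'P] : exists2 B, open_nbhs x B & B `<=` P by rewrite nbhsE in Px.
have [Q' [oQ' Q'y] Q'Q] : exists2 B, open_nbhs y B & B `<=` Q by rewrite nbhsE in Qy.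
exists (@half_pi G L @` P', @half_pi G L @` Q') => /=.
  split; apply: open_nbhs_nbhs; split; try exact: half_pi_open.
    by exists x.
  by exists y.
move=> [_ _] /= [[x' P'x' <-] [y' Q'y' <-]].
rewrite /preimage/= -half_pi_is_zmod_morphism.
by apply: (PQ (x', y')); split; [exact: P'P|exact: Q'Q].
Qed.

HB.instance Definition _ :=
  PreTopologicalNmodule_isTopologicalZmodule.Build (half_quot L)
    half_quot_sub_continuous.

End HalfTopology.

Section FixedSpace.
Variables (K : numClosedFieldType) (G : zmodType) (H : hilbertType K).
Variables (L : zmodClosed G) (W : G -> unitary H).

Definition fixed_pred : {pred H} :=
  fun psi => `[< forall a, a \in L -> W a psi = psi >].

Lemma fixed_submod_closed : submod_closed fixed_pred.
Proof.
split; first by apply/asboolP => a _; rewrite linear0.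
move=> c x y /asboolP xf /asboolP yf; apply/asboolP => a aL.
by rewrite linearP xf// yf.
Qed.

HB.instance Definition _ :=
  GRing.isSubmodClosed.Build K H fixed_pred fixed_submod_closed.

Definition fixed_space := {psi : H | psi \in fixed_pred}.

HB.instance Definition _ := SubChoice.on fixed_space.
HB.instance Definition _ := [SubChoice_isSubLmodule of fixed_space by <:].

Definition fixed_norm (psi : fixed_space) : K := `|val psi|.

Lemma fixed_normD x y : fixed_norm (x + y) <= fixed_norm x + fixed_norm y.
Proof. by rewrite /fixed_norm raddfD ler_normD. Qed.

Lemma fixed_normZ l x : fixed_norm (l *: x) = `|l| * fixed_norm x.
Proof. by rewrite /fixed_norm linearZ normrZ. Qed.

Lemma fixed_norm0_eq0 x : fixed_norm x = 0 -> x = 0.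
Proof. by move=> /normr0_eq0 x0; apply: val_inj; rewrite x0 raddf0. Qed.

HB.instance Definition _ := Lmodule_isNormed.Build K fixed_space
  fixed_normD fixed_normZ fixed_norm0_eq0.

Lemma fixed_closed : closed [set psi | psi \in fixed_pred].
Proof.
have -> : [set psi | psi \in fixed_pred] =
    \bigcap_(a in [set a | a \in L]) ((fun psi => W a psi - psi) @^-1` [set 0]).
  apply/seteqP; split=> psi /=.
    by move=> /asboolP psif a /= /psif ->; rewrite subrr.
  by move=> psif; apply/asboolP => a /psif /= /subr0_eq.
apply: closed_bigI => a _; apply: preimage_closed.
  by move=> psi _; apply: continuousB; [exact: unitary_continuous|exact: cvg_id].
exact/accessible_closed_set1/hausdorff_accessible/norm_hausdorff.
Qed.

Lemma fixed_complete (F : set_system fixed_space) :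
  ProperFilter F -> cauchy F -> cvg F.
Proof.
move=> PF /cauchy_ballP Fc.
have : cauchy ((val : fixed_space -> H) @ F).
  apply/cauchy_ballP => e e0.
  have [[P Q] /= [FP FQ] PQ] := Fc e e0.
  exists (val @` P, val @` Q) => /=.
    by split; [apply: filterS FP|apply: filterS FQ] => x ? /=; exists x.
  move=> [_ _] /= [[x Px <-] [y Qy <-]].
  have /= := PQ (x, y) (conj Px Qy).
  rewrite -!ball_normE /=.
  by change (`|val (x - y)| < e -> `|val x - val y| < e); rewrite raddfB.
move=> /cauchy_cvg /cvg_ex [l Fl].
have lf : l \in fixed_pred.
  apply: (@closed_cvg _ _ F _ (val : fixed_space -> H)
    [set psi | psi \in fixed_pred] fixed_closed _ l Fl).
  by apply: nearW => x /=; exact: (valP x).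
apply/cvg_ex; exists (exist _ l lf : fixed_space).
move/cvgrPdist_lt: Fl => Fl.
apply/(@cvgrPdist_lt K fixed_space _ F _ id) => e e0.
near=> x.
change (`|val ((exist _ l lf : fixed_space) - x)| < e).
rewrite raddfB /=; near: x; exact: Fl.
Unshelve. all: by end_near. Qed.

HB.instance Definition _ := Uniform_isComplete.Build fixed_space fixed_complete.

Definition fixed_inner (x y : fixed_space) : K := inner (val x) (val y).

Lemma fixed_inner_zmodl v : zmod_morphism (fixed_inner^~ v).
Proof. by move=> x y; rewrite /fixed_inner raddfB linearBl. Qed.

Lemma fixed_inner_zmodr v : zmod_morphism (fixed_inner v).
Proof. by move=> x y; rewrite /fixed_inner [val (x - y)]raddfB raddfB. Qed.

Lemma fixed_innerZl v : scalable_for *%R (fixed_inner^~ v).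
Proof. by move=> c x; rewrite /fixed_inner linearZ linearZl_LR. Qed.

Lemma fixed_innerZr v :
  scalable_for ((@Num.conj K : K -> K) \; *%R) (fixed_inner v).
Proof. by move=> c x; rewrite /fixed_inner [val (c *: x)]linearZ; exact: linearr_subproof. Qed.

HB.instance Definition _ := isBilinear.Build K fixed_space fixed_space K
  *%R ((@Num.conj K : K -> K) \; *%R) fixed_inner
  fixed_inner_zmodl fixed_inner_zmodr fixed_innerZl fixed_innerZr.

Lemma fixed_inner_herm (x y : fixed_space) :
  fixed_inner x y = (-1) ^+ false * (fixed_inner y x)^*.
Proof. exact: hermitian_subproof. Qed.

HB.instance Definition _ := isHermitianSesquilinear.Build K fixed_space
  false (@Num.conj K : K -> K) fixed_inner fixed_inner_herm.

Lemma fixed_inner_gt0 (x : fixed_space) : x != 0 -> 0 < fixed_inner x x.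
Proof. by move=> x0; apply: neq0_dnorm_gt0. Qed.

HB.instance Definition _ := isDotProduct.Build K fixed_space fixed_inner
  fixed_inner_gt0.

Lemma fixed_sqr_normE (x : fixed_space) : `|x| ^+ 2 = fixed_inner x x.
Proof. exact: sqr_normE. Qed.

HB.instance Definition _ :=
  hasInnerProduct.Build K fixed_space fixed_sqr_normE.

End FixedSpace.

(* W0 \o half_pi is projectively equivalent to the restriction W^L of W to     *)
(* L/2 acting on fixed_space L W; the operators of W^L are the restrictions    *)
(* of the operators of W, so the identity is written in H.                     *)
Definition lift_equivalent (K : numClosedFieldType) (G : topologicalZmodType)
    (H : hilbertType K) (L : zmodClosed G) (W : G -> unitary H)
    (W0 : half_quot L -> unitary (fixed_space L W)) :=
  exists2 a : half_group L -> K, forall x, `|a x| = 1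
    & forall x psi, val (W0 (half_pi x) psi) = a x *: W (val x) (val psi).

(* Main.v *)
From HB Require Import structures.
Require Import Defs.
From mathcomp Require Import all_boot all_order all_algebra.
From mathcomp Require Import all_classical all_reals all_analysis.
From mathcomp Require Import ring.
Import GRing.Theory Num.Theory numFieldNormedType.Exports.

(** On L/2 the operators of W commute up to the scalar m(x, y) / m(y, x), which
    is m(x, y)^2 because m is alternating.  The square of this scalar is
    m(2x, 2y) = 1, so it is a sign, and it is 1 when x lies in L, where it
    equals m(x, 2y).  It therefore has the form (-1)^b for a bilinear
    alternating form b on the F_2-vector space (L/2)/L, and passing from W to
    the projectively equivalent W0 does not change it.

    The form b is nondegenerate: if m(x, 2y) = 1 for all y in L/2, then x
    annihilates L, since 2-regularity makes doubling map L/2 onto L; and the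
    annihilator of a maximal isotropic subgroup is that subgroup
    ([maximal_isotropic_annihilator]).

    Hence the relations W0(e_i) W0(e_j) = - W0(e_j) W0(e_i) ask for a basis of a
    symplectic space over F_2 of dimension 2d in which all the pairings of
    distinct vectors are 1.  Such a basis is built two vectors at a time
    ([hollow_basis]).  Finally W0(v)^2 is a scalar of modulus 1 for each v,
    since 2v = 0, so that dividing W0(v) by a square root of it gives an
    equivalent projective representation with W0(v)^2 = 1; commutators are not
    affected ([rescale_projective_rep]). *)

Set Implicit Arguments.
Unset Strict Implicit.
Unset Printing Implicit Defensive.

Local Open Scope classical_set_scope.
Local Open Scope card_scope.
Local Open Scope ring_scope.

(** * Bases of a symplectic space over F_2 with all pairings equal to 1 *)

Lemma F2_cases (c : 'F_2) : c = 0 \/ c = 1.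
Proof. by case: c => -[|[|n]] // lt_c; [left|right]; apply/val_inj. Qed.

Lemma F2_neq0 (c : 'F_2) : c != 0 -> c = 1.
Proof. by case: (F2_cases c) => ->. Qed.

Lemma F2_pchar : 2%N \in [pchar 'F_2].
Proof. exact: pchar_Fp. Qed.

Lemma F2_mulrn (c : 'F_2) n : ~~ odd n -> c *+ n = 0.
Proof.
move=> n_even; rewrite -(even_halfK n_even) -muln2 mulnC mulrnA mulr2n.
by rewrite addrr_pchar2// mul0rn.
Qed.

Section AnticommutingBasis.
Variables (V : lmodType 'F_2) (b : V -> V -> 'F_2).
Hypothesis bDl : forall u v w, b (u + v) w = b u w + b v w.
Hypothesis b_sym : forall u v, b u v = b v u.
Hypothesis b_alt : forall v, b v v = 0.
Hypothesis b_nondeg : forall u : V, u != 0 -> exists v, b u v != 0.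

Definition lincomb {n} (e : nat -> V) (c : 'I_n -> 'F_2) := \sum_(i < n) c i *: e i.

(** The first n vectors have the Gram matrix J - I, with J the all-one matrix.
    Indexing by nat lets a family be extended without casts between ordinal
    types. *)
Definition hollow (n : nat) (e : nat -> V) :=
  forall i j, (i < n)%N -> (j < n)%N -> i != j -> b (e i) (e j) = 1.

Lemma form0l w : b 0 w = 0.
Proof. by apply: (addrI (b 0 w)); rewrite -bDl !addr0. Qed.

Lemma formBl u v w : b (u - v) w = b u w - b v w.
Proof. by apply: (addIr (b v w)); rewrite -bDl !subrK. Qed.

Lemma formDr u v w : b u (v + w) = b u v + b u w.
Proof. by rewrite b_sym bDl !(b_sym u). Qed.

Lemma form_lincomb n (e : nat -> V) (c : 'I_n -> 'F_2) w :
  b (lincomb e c) w = \sum_(i < n) c i * b (e i) w.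
Proof.
rewrite /lincomb (big_morph (b^~ w) (fun u v => bDl u v w) (form0l w)).
apply: eq_bigr => i _; case: (F2_cases (c i)) => ->.
  by rewrite scale0r form0l mul0r.
by rewrite scale1r mul1r.
Qed.

Lemma form_lincomb_hollow n e (c : 'I_n -> 'F_2) (j : 'I_n) : hollow n e ->
  b (lincomb e c) (e j) = \sum_(i < n) c i - c j.
Proof.
move=> e_hollow; rewrite form_lincomb (bigD1 j)//= b_alt mulr0 add0r.
rewrite [in RHS](bigD1 j)//= addrAC subrr add0r.
by apply: eq_bigr => i ij; rewrite e_hollow// mulr1.
Qed.

(** For n even, J - I is invertible over F_2: a relation with coefficients c_i,
    paired with e_j, says that every c_j is the sum s of all of them, and then
    s = n s = 0.  For n odd the sum of the vectors may vanish, as it does for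
    the three nonzero vectors of a plane. *)
Lemma hollow_free n e (c : 'I_n -> 'F_2) :
  ~~ odd n -> hollow n e -> lincomb e c = 0 -> forall i, c i = 0.
Proof.
move=> n_even e_hollow ce0.
have cE j : c j = \sum_(i < n) c i.
  by apply/esym/eqP; rewrite -subr_eq0 -(form_lincomb_hollow c j e_hollow) ce0 form0l.
move=> j; rewrite cE (eq_bigr (fun=> \sum_(i < n) c i)) => [|i _]; last exact: cE.
by rewrite sumr_const card_ord F2_mulrn.
Qed.

(** The span of a hollow family of even size is nondegenerate, so that every
    vector has an orthogonal projection to it. *)
Lemma hollow_complement n e v : ~~ odd n -> hollow n e ->
  exists c : 'I_n -> 'F_2,
    forall j, (j < n)%N -> b (v - lincomb e c) (e j) = 0.
Proof.
move=> n_even e_hollow; pose s := \sum_(i < n) b v (e i).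
(* Solves sum_i c_i - c_j = b v (e j): summing over j gives sum_i c_i = s, since
   n = 0 and -1 = 1 in F_2. *)
exists (fun i => s - b v (e i)) => j lt_jn.
rewrite formBl (form_lincomb_hollow _ (Ordinal lt_jn) e_hollow)/= sumrB.
rewrite sumr_const card_ord F2_mulrn// -/s sub0r -opprD opprK (addrA s).
by rewrite addrr_pchar2 ?F2_pchar// sub0r subrr.
Qed.

Lemma form_lincomb_orth n e (c : 'I_n -> 'F_2) w :
  (forall j, (j < n)%N -> b w (e j) = 0) -> b w (lincomb e c) = 0.
Proof.
by move=> w_orth; rewrite b_sym form_lincomb big1// => i _; rewrite b_sym w_orth// mulr0.
Qed.

(** In the orthogonal complement of the span choose f and g with b f g = 1.
    They pair to 0 with the family; adding to both the sum s of the family,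
    which pairs to 1 with each of its n vectors because n - 1 is odd, corrects
    this, and keeps the pairing of the two new vectors at 1. *)
Lemma hollow_extend n e v : ~~ odd n -> hollow n e ->
  (forall c : 'I_n -> 'F_2, v <> lincomb e c) -> exists e', hollow n.+2 e'.
Proof.
move=> n_even e_hollow v_span.
have [c f_orth] := hollow_complement v n_even e_hollow.
set f := v - lincomb e c in f_orth.
have /b_nondeg [w fw] : f != 0.
  by rewrite subr_eq0; apply/eqP/v_span.
have [c' g_orth] := hollow_complement w n_even e_hollow.
set g := w - lincomb e c' in g_orth.
have fg : b f g = 1.
  apply: F2_neq0; rewrite b_sym formBl (b_sym _ f) (b_sym _ f).
  by rewrite (form_lincomb_orth _ f_orth) subr0.
pose s := lincomb e (fun _ : 'I_n => 1).
have se j : (j < n)%N -> b s (e j) = 1.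
  move=> lt_jn; rewrite (form_lincomb_hollow _ (Ordinal lt_jn) e_hollow).
  by rewrite sumr_const card_ord F2_mulrn// sub0r oppr_pchar2// F2_pchar.
have fs : b f s = 0 by exact: form_lincomb_orth.
have gs : b g s = 0 by exact: form_lincomb_orth.
(* Keeps formDr from expanding the differences hidden in f and g. *)
clearbody f g s.
pose e' i := if (i < n)%N then e i else if i == n then s + f else s + g.
exists e'.
have e'_lt i j : (i < j)%N -> (j < n.+2)%N -> b (e' i) (e' j) = 1.
  move=> lt_ij lt_jn; rewrite /e'; case: (ltnP j n) => [jn|le_nj].
    by rewrite (ltn_trans lt_ij jn) e_hollow ?(ltn_trans lt_ij jn) ?(ltn_eqF lt_ij).
  case: (eqVneq j n) => [jE|j_n].
    by rewrite -jE lt_ij b_sym bDl se -?jE// f_orth -?jE// addr0.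
  have {j_n le_nj} jE : j = n.+1.
    by apply/eqP; rewrite eqn_leq -ltnS lt_jn/= ltn_neqAle eq_sym j_n.
  move: lt_ij; rewrite jE ltnS leq_eqVlt => /orP[/eqP ->|lt_in].
    by rewrite ltnn eqxx bDl !formDr b_alt (b_sym s) gs fs !add0r.
  by rewrite lt_in b_sym bDl se// g_orth// addr0.
move=> i j lt_in lt_jn; rewrite neq_ltn => /orP[] lt_ij; first exact: e'_lt.
by rewrite b_sym e'_lt.
Qed.

(** Used in both directions: a hollow family of size less than 2d does not span,
    hence can be extended, and one of size 2d spans. *)
Lemma free_spans_card N n (e : nat -> V) : [set: V] #= `I_N ->
    (forall c : 'I_n -> 'F_2, lincomb e c = 0 -> forall i, c i = 0) ->
  (forall v, exists c : 'I_n -> 'F_2, v = lincomb e c) <-> (2 ^ n = N)%N.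
Proof.
move=> /card_set_bijP[g [g_lt g_inj g_surj]] e_free.
have gN v : (g v < N)%N by exact: g_lt.
pose h (c : {ffun 'I_n -> 'F_2}) : 'I_N := Ordinal (gN (lincomb e c)).
have h_inj : injective h.
  move=> c c' [] /(g_inj _ _ (in_setT _) (in_setT _)) cc'.
  apply/ffunP => i; apply/subr0_eq.
  have := e_free (fun i => c i - c' i); apply.
  rewrite -[RHS](subrr (lincomb e c')) -{1}cc' /lincomb -sumrB.
  by apply: eq_bigr => j _; rewrite scalerBl.
have cardT : #|{ffun 'I_n -> 'F_2}| = (2 ^ n)%N by rewrite card_ffun !card_ord.
split=> [e_span|nN].
  apply/eqP; rewrite -cardT -[X in _ == X](card_ord N) eqn_leq.
  rewrite (leq_card _ h_inj)/= -(card_codom h_inj).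
  apply/subset_leq_card/fintype.subsetP => k _.
  have [v _ gv] := g_surj k (ltn_ord k).
  have [c vE] := e_span v; apply/codomP; exists [ffun i => c i].
  apply/val_inj; rewrite /= -gv vE; congr (g _).
  by apply: eq_bigr => i _; rewrite ffunE.
move=> v; have [|h' _ hK] := @inj_card_bij _ _ h h_inj.
  by rewrite cardT nN card_ord.
exists (h' (Ordinal (gN v))).
apply: (g_inj _ _ (in_setT _) (in_setT _)).
by have /(congr1 val) := hK (Ordinal (gN v)).
Qed.

Lemma hollow_basis d : [set: V] #= `I_(2 ^ (2 * d)) ->
  exists2 e : 'I_(2 * d) -> V, is_basis (F := 'F_2) e &
    forall i j, i != j -> b (e i) (e j) = 1.
Proof.
move=> cardV.
have even2 k : ~~ odd (2 * k) by rewrite mul2n odd_double.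
have [e e_hollow] : exists e, hollow (2 * d) e.
  elim: {-2}d (leqnn d) => [_|k IHk lt_kd]; first by exists (fun=> 0).
  have [e e_hollow] := IHk (ltnW lt_kd).
  have [v v_span] : exists v, forall c : 'I_(2 * k) -> 'F_2, v <> lincomb e c.
    apply: contrapT => no_v.
    have e_span v : exists c : 'I_(2 * k) -> 'F_2, v = lincomb e c.
      apply: contrapT => v_span; apply: no_v; exists v => c vE.
      by apply: v_span; exists c.
    have e_free (c : 'I_(2 * k) -> 'F_2) := @hollow_free _ e c (even2 k) e_hollow.
    have /eqP := (free_spans_card cardV e_free).1 e_span.
    by rewrite eqn_exp2l// eqn_pmul2l// ltn_eqF.
  have [e' e'_hollow] := hollow_extend (even2 k) e_hollow v_span.
  by exists e'; rewrite mulnS.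
have e_free (c : 'I_(2 * d) -> 'F_2) := @hollow_free _ e c (even2 d) e_hollow.
exists (fun i : 'I_(2 * d) => e i); first split=> //.
  exact: (free_spans_card cardV e_free).2.
by move=> i j ij; apply: e_hollow.
Qed.
End AnticommutingBasis.

(** * Annihilators for a bicharacter *)

Section Bicharacter.
Variables (K : numClosedFieldType) (G : topologicalZmodType).
Variable m : bicharacter K G.

Lemma bicharDl x y z : m (x + y) z = m x z * m y z.
Proof. by case: (bichar_l m z) => _ _; apply. Qed.

Lemma bicharDr x y z : m x (y + z) = m x y * m x z.
Proof. by case: (bichar_r m x) => _ _; apply. Qed.

Lemma bichar_norm x y : `|m x y| = 1.
Proof. by case: (bichar_r m x) => _ + _; apply. Qed.

Lemma bichar_neq0 x y : m x y != 0.
Proof. by rewrite -normr_eq0 bichar_norm oner_eq0. Qed.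

Lemma bichar0l y : m 0 y = 1.
Proof. by apply: (mulfI (bichar_neq0 0 y)); rewrite -bicharDl addr0 mulr1. Qed.

Lemma bicharBl x y z : m x z = 1 -> m y z = 1 -> m (x - y) z = 1.
Proof. by move=> xz yz; rewrite -[LHS]mulr1 -{1}yz -bicharDl subrK. Qed.

Definition annihilator (S : set G) : {pred G} :=
  fun x => `[< forall s, S s -> m x s = 1 >].

Lemma annihilator_zmod_closed S : zmod_closed (annihilator S).
Proof.
split=> [|x y /asboolP xS /asboolP yS]; apply/asboolP => s Ss.
  exact: bichar0l.
by rewrite bicharBl ?xS ?yS.
Qed.

HB.instance Definition _ S :=
  GRing.isZmodClosed.Build G (annihilator S) (annihilator_zmod_closed S).

(** If x annihilates L, then L and x generate an isotropic subgroup.  Instead of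
    the subgroup generated by the union S of L and x, the proof uses the double
    annihilator B of S: as S annihilates itself, B is contained in the
    annihilator of S, and every element of the latter is annihilated by B. *)
Lemma maximal_isotropic_annihilator (L : zmodClosed G) x :
  Defs.alternating m -> maximal_isotropic m L ->
  (forall y, y \in L -> m x y = 1) -> x \in L.
Proof.
move=> [m_alt mxx] [L_iso L_max] xL.
have m_sym y z : m y z = 1 -> m z y = 1.
  by move=> yz; have := m_alt y z; rewrite yz mul1r.
pose S := [set y | y \in L \/ y = x].
have S_iso y z : S y -> S z -> m y z = 1.
  move=> [yL|->] [zL|->]; [exact: L_iso|exact/m_sym/xL|exact: xL|exact: mxx].
pose B := annihilator [set y | y \in annihilator S].
have SB y : S y -> y \in B.
  by move=> Sy; apply/asboolP => z /asboolP zS; apply/m_sym/zS.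
apply: (L_max B) => [y z /asboolP yB /asboolP zB|y yL|].
- apply: yB; apply/asboolP => s Ss; apply: zB.
  by apply/asboolP => t; exact: S_iso.
- by apply: SB; left.
- by apply: SB; right.
Qed.

End Bicharacter.

(** * The commutator form on (L/2)/L *)

Section CommutatorForm.
Variables (K : numClosedFieldType) (G : topologicalZmodType).
Variables (m : bicharacter K G) (L : zmodClosed G).
Hypothesis m_alt : Defs.alternating m.
Hypothesis L_max : maximal_isotropic m L.

Local Notation sign c := ((-1) ^+ nat_of_ord c).

Lemma sign_F2D (a b : 'F_2) : sign (a + b) = sign a * sign b :> K.
Proof.
case: (F2_cases a) => ->; first by rewrite add0r [sign 0]expr0 mul1r.
case: (F2_cases b) => ->; first by rewrite addr0 [sign 0]expr0 mulr1.
by rewrite addrr_pchar2 ?F2_pchar// [sign 1]expr1 mulrNN mulr1.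
Qed.

Lemma sign_F2_inj (a b : 'F_2) : sign a = sign b :> K -> a = b.
Proof.
have N1 : (-1 == 1 :> K) = false by rewrite eqNr oner_eq0.
by case: (F2_cases a) (F2_cases b) => -> [] -> //= /eqP;
  rewrite ?expr0 ?expr1 ?[1 == _]eq_sym N1.
Qed.

(** The exponent of the sign m(x, y)^2, read off on representatives; see
    [sign_commutator_form]. *)
Definition commutator_form (u v : half_quot L) : 'F_2 :=
  if m (val (repr u)) (val (repr v)) ^+ 2 == 1 then 0 else 1.

(** The value is m(x, 2y), and both x and 2y lie in the isotropic subgroup L. *)
Lemma bichar_half_sqr1 (x y : half_group L) : val x \in L ->
  m (val x) (val y) ^+ 2 = 1.
Proof.
move=> xL; rewrite expr2 -bicharDr -mulr2n.
by apply: L_max.1 => //; exact: (valP y).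
Qed.

(** The square of m(x, y)^2 is m(2x, 2y), where 2x and 2y lie in L. *)
Lemma bichar_sqr_sign (x y : half_group L) :
  m (val x) (val y) ^+ 2 = 1 \/ m (val x) (val y) ^+ 2 = -1.
Proof.
have /eqP : (m (val x) (val y) ^+ 2) ^+ 2 = 1.
  rewrite !expr2 -bicharDl -bicharDr -!mulr2n.
  by apply: L_max.1; [exact: (valP x)|exact: (valP y)].
by rewrite sqrf_eq1 => /orP[] /eqP; [left|right].
Qed.

Lemma half_valD (x y : half_group L) : val (x + y) = val x + val y.
Proof. exact: raddfD. Qed.

Lemma half_pi_eq_sub (x y : half_group L) : half_pi x = half_pi y -> val (x - y) \in L.
Proof. by move=> xy; rewrite -half_pi_eq0 half_pi_is_zmod_morphism xy subrr. Qed.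

(** The two sides are inverse to each other, and are signs. *)
Lemma bichar_sym_sqr (x y : half_group L) :
  m (val x) (val y) ^+ 2 = m (val y) (val x) ^+ 2.
Proof.
have yx := m_alt.1 (val y) (val x).
apply: (mulfI (expf_neq0 2 (bichar_neq0 m (val y) (val x)))).
rewrite -exprMn yx expr1n.
by case: (bichar_sqr_sign y x) => ->; rewrite ?mulr1 ?mulrNN ?mulr1.
Qed.

Lemma bichar_sqr_half_pi (x x' y : half_group L) : half_pi x = half_pi x' ->
  m (val x) (val y) ^+ 2 = m (val x') (val y) ^+ 2.
Proof.
move=> /half_pi_eq_sub xx'; rewrite -[x in LHS](subrK x') half_valD bicharDl exprMn.
by rewrite (bichar_half_sqr1 _ xx') mul1r.
Qed.

Lemma sign_commutator_form (x y : half_group L) :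
  sign (commutator_form (half_pi x) (half_pi y)) = m (val x) (val y) ^+ 2.
Proof.
have xr : half_pi (repr (half_pi x)) = half_pi x by exact: reprK.
have yr : half_pi (repr (half_pi y)) = half_pi y by exact: reprK.
rewrite -(bichar_sqr_half_pi _ xr) bichar_sym_sqr.
rewrite -(bichar_sqr_half_pi _ yr) bichar_sym_sqr.
rewrite /commutator_form; case: eqP => [->//|ne1].
by case: (bichar_sqr_sign (repr (half_pi x)) (repr (half_pi y))) => // ->.
Qed.

Lemma commutator_formDl u v w :
  commutator_form (u + v) w = commutator_form u w + commutator_form v w.
Proof.
have [x <-] := half_pi_surj u; have [y <-] := half_pi_surj v.
have [z <-] := half_pi_surj w; rewrite -[half_pi x + _]raddfD; apply: sign_F2_inj.
by rewrite sign_F2D !sign_commutator_form half_valD bicharDl exprMn.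
Qed.

Lemma commutator_form_sym u v : commutator_form u v = commutator_form v u.
Proof. by rewrite /commutator_form bichar_sym_sqr. Qed.

Lemma commutator_form_alt v : commutator_form v v = 0.
Proof. by rewrite /commutator_form m_alt.2 expr1n eqxx. Qed.

(** By 2-regularity every y in L is 2z with z in L/2, and m(x, y) = m(x, z)^2; so
    if x pairs trivially with L/2, it annihilates L. *)
Lemma commutator_form_nondeg (u : half_quot L) : two_regular G ->
  u != 0 -> exists v, commutator_form u v != 0.
Proof.
move=> [h hK Kh]; have [x <-] := half_pi_surj u; rewrite half_pi_eq0 => xL.
apply: contrapT => nov; move/negP: xL; apply.
apply: (maximal_isotropic_annihilator m_alt L_max) => y yL.
have hyL : h y \in Defs.half L by rewrite inE Kh.
pose z : half_group L := exist _ (h y) hyL.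
have : commutator_form (half_pi x) (half_pi z) = 0.
  by apply: contrapT => /eqP xz; apply: nov; exists (half_pi z).
move/(congr1 (fun c : 'F_2 => sign c : K)); rewrite /= sign_commutator_form expr0.
by rewrite expr2 -bicharDr -mulr2n Kh.
Qed.

End CommutatorForm.

(** * Discreteness of (L/2)/L *)

Lemma discrete_borel_fun (X Y : topologicalType) (f : X -> Y) :
  (forall A : set X, open A) -> borel_fun f.
Proof. by move=> X_discr B _; apply: sub_sigma_algebra; exact: X_discr. Qed.

Lemma discrete_prod (X Y : topologicalType) :
  (forall A : set X, open A) -> (forall B : set Y, open B) ->
  forall C : set (X * Y), open C.
Proof.
move=> X_discr Y_discr C; rewrite openE => -[x y] Cxy.
exists ([set x], [set y]) => /=.
  by split; apply: open_nbhs_nbhs; split.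
by move=> [_ _] [/= -> ->].
Qed.

(** A compact subgroup of a Hausdorff group is closed, so that the points of the
    quotient are closed; a finite space with closed points is discrete.  It
    follows that all the Borel conditions on (L/2)/L hold trivially. *)
Lemma half_quot_discrete (G : topologicalZmodType) (L : zmodClosed G) :
  hausdorff_space G -> compact [set x : G | x \in L] ->
  finite_set [set: half_quot L] -> forall A : set (half_quot L), open A.
Proof.
move=> G_haus L_cpt V_fin A; rewrite -[A]setCK openC.
have -> : ~` A = \bigcup_(v in ~` A) [set v] by rewrite bigcup_imset1 image_id.
apply: closed_bigcup.
  exact: sub_finite_set V_fin.
move=> v _; have [x <-] := half_pi_surj v.
rewrite -[[set _]]setCK closedC.
suff : open (~` [set y : half_group L | val (y - x) \in L]).
  rewrite {2}/open /= /half_quot_open; congr open; rewrite preimage_setC; congr (~` _).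
  apply/seteqP; split=> y; last exact: half_pi_eq_sub.
  move=> yx; apply/eqP; rewrite -subr_eq0 -half_pi_is_zmod_morphism half_pi_eq0.
  exact: yx.
rewrite openC.
have -> : [set y : half_group L | val (y - x) \in L] =
  (fun y : half_group L => val (y - x)) @^-1` [set x | x \in L] by [].
apply: preimage_closed; last exact: compact_closed.
move=> y _; apply: (@continuous_comp _ _ _ (fun y : half_group L => y - x) val).
  exact: subr_continuous.
exact: half_val_continuous.
Qed.

(** * Rescaling a projective representation *)

Section Rescaling.
Variables (K : numClosedFieldType) (H : hilbertType K).

Lemma scale_unitary_inner (c : K) (U : unitary H) : `|c| = 1 ->
  forall x y, inner ((c \*: U) x) ((c \*: U) y) = inner x y.
Proof.
move=> c1 x y /=; rewrite linearZl_LR linearZr_LR /= unitary_inner mulrA.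
by rewrite -normCK c1 expr1n mul1r.
Qed.

Lemma scale_unitary_surj (c : K) (U : unitary H) : `|c| = 1 ->
  forall y, exists x, (c \*: U) x = y.
Proof.
move=> c1 y; have [x xE] := unitary_surj U (c^-1 *: y).
by exists x; rewrite /= xE scalerA divff ?scale1r// -normr_eq0 c1 oner_eq0.
Qed.

Definition scale_unitary (c : K) (U : unitary H) (c1 : `|c| = 1) : unitary H :=
  Unitary (scale_unitary_inner U c1) (scale_unitary_surj U c1).

(** If 2x = 0, then U(x)^2 is the scalar n(x, x), where n is the multiplier of U,
    and U(x) can be divided by a square root of it.  The result is again Borel
    for any choice of the roots because A is discrete. *)
Lemma rescale_projective_rep (A : topologicalZmodType) (U : A -> unitary H) :
  (forall B : set A, open B) -> is_projective_rep U ->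
  exists V : A -> unitary H, [/\ is_projective_rep V, projectively_equivalent V U
    & forall x, x *+ 2 = 0 -> forall psi, V x (V x psi) = psi].
Proof.
move=> A_discr [n n_mult [_ U0 UM]].
have [n1 _ nr nl nP] := n_mult.
have n_neq0 x y : n x y != 0 by rewrite -normr_eq0 n1 oner_eq0.
(* The root chosen for x = 0 has to be 1, since V 0 = 1; sqrtC 1 = 1 ensures it. *)
pose c x := sqrtC (n x x)^-1.
have c_sqr x : c x ^+ 2 = (n x x)^-1 by exact: sqrtCK.
have c_norm x : `|c x| = 1.
  apply/eqP; rewrite -(@eqrXn2 _ 2) ?normr_ge0 ?ler01// -normrX c_sqr.
  by rewrite normfV n1 invr1 expr1n.
have c_neq0 x : c x != 0 by rewrite -normr_eq0 c_norm oner_eq0.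
have c0 : c 0 = 1 by rewrite /c nr invr1 sqrtC1.
exists (fun x => scale_unitary (U x) (c_norm x)); split.
(* The multiplier of V is n times the coboundary of c. *)
- exists (fun x y => c x * c y / c (x + y) * n x y).
    split=> [x y||x|x|x y z].
    + by rewrite !normrM normfV !c_norm n1 invr1 !mulr1.
    + by apply: discrete_borel_fun; exact: discrete_prod.
    + by rewrite addr0 c0 nr !mulr1 divff.
    + by rewrite add0r c0 nl mul1r mulr1 divff.
    + rewrite addrA; transitivity
        (c x * c y * c z / c (x + y + z) * (n (x + y) z * n x y)).
        by field; rewrite !c_neq0.
      by rewrite nP; field; rewrite !c_neq0.
  split=> [|psi|x y psi] /=; first exact: discrete_borel_fun.
    by rewrite U0 c0 scale1r.
  rewrite linearZ /= UM !scalerA; congr (_ *: _).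
  by field; rewrite c_neq0.
- by exists c.
- move=> x x2 psi /=.
  by rewrite linearZ /= UM !scalerA -mulr2n x2 U0 -expr2 c_sqr mulVf// scale1r.
Qed.

End Rescaling.

(** * Anticommuting generators *)

Theorem theorem12 (R : realType) (G : topologicalZmodType)
    (m : bicharacter R[i] G) (L : zmodClosed G)
    (H : hilbertType R[i]) (W : G -> unitary H)
    (W0 : half_quot L -> unitary (fixed_space L W)) (d : nat) :
  hausdorff_space G ->
  locally_compact [set: G] ->
  separable G ->
  two_regular G ->
  symplectic m ->
  compact [set x : G | x \in L] ->
  maximal_isotropic m L ->
  [set x : G | x \in L] <> [set x *+ 2 | x in [set x : G | x \in L]] ->
  is_rep m W ->
  irreducible_rep W ->
  is_projective_rep W0 ->
  lift_equivalent W0 ->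
  (0 < d)%N ->
  [set: half_quot L] #= `I_(2 ^ (2 * d)) ->
  exists e : 'I_(2 * d) -> half_quot L,
    [/\ is_basis (F := 'F_2) e,
        forall i j, i != j ->
          forall psi, W0 (e i) (W0 (e j) psi) = - W0 (e j) (W0 (e i) psi)
      & exists V : half_quot L -> unitary (fixed_space L W),
          [/\ is_projective_rep V,
              projectively_equivalent V W0,
              forall i psi, V (e i) (V (e i) psi) = psi
            & forall i j, i != j ->
                forall psi, V (e i) (V (e j) psi) = - V (e j) (V (e i) psi)]].
Proof.
move=> G_haus _ _ two_reg [m_alt _] L_cpt L_max _ [_ _ WM] _ W0_rep [a _ W0E] _ cardV.
have V_fin : finite_set [set: half_quot L] by apply/finite_setP; exists (2 ^ (2 * d))%N.
have V_discr := half_quot_discrete G_haus L_cpt V_fin.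
have [e e_basis e_form] := hollow_basis (commutator_formDl m_alt L_max)
  (commutator_form_sym m_alt L_max) (commutator_form_alt m_alt)
  (fun u => commutator_form_nondeg m_alt L_max two_reg) cardV.
have W0_comm u v psi : W0 u (W0 v psi) =
    (-1) ^+ nat_of_ord (commutator_form m u v) *: W0 v (W0 u psi).
  have [x <-] := half_pi_surj u; have [y <-] := half_pi_surj v.
  have WW (x' y' : half_group L) : val (W0 (half_pi x') (W0 (half_pi y') psi)) =
      (a x' * a y' * m (val x') (val y')) *: W (val x' + val y') (val psi).
    by rewrite W0E W0E linearZ /= WM !scalerA.
  apply: val_inj; rewrite [RHS]linearZ /= !WW (sign_commutator_form m_alt L_max).
  rewrite scalerA [val y + _]addrC; congr (_ *: _).
  have yx := m_alt.1 (val x) (val y).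
  transitivity
    (a y * a x * m (val x) (val y) * (m (val x) (val y) * m (val y) (val x))).
    by rewrite yx; ring.
  by ring.
have W0_anti i j : i != j ->
    forall psi, W0 (e i) (W0 (e j) psi) = - W0 (e j) (W0 (e i) psi).
  by move=> ij psi; rewrite W0_comm e_form// scaleN1r.
have [V [V_rep V_eq V_sqr]] := rescale_projective_rep V_discr W0_rep.
exists e; split=> //; exists V; split=> // [i psi|i j ij psi].
  by apply: V_sqr; exact: half_quot_mulr2n.
have [c _ VE] := V_eq.
by rewrite !VE !linearZ /= W0_anti// !scalerN !scalerA mulrC.
Qed.
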